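(* Let $A=[a_{ij}]\in[0,1]^{n\times m}$ and $b=[b_i]\in[0,1]^{n\times 1}$. Let $\Delta=\inf_{c\in\mathcal C}\Vert b-c\Vert$ be the Chebyshev distance associated to the second member $b$ of the system of max-product fuzzy relational equations $\max_{1\le j\le m} a_{ij}\cdot x_j=b_i$ ($1\le i\le n$), where $\mathcal C$ is the set of $c\in[0,1]^{n\times 1}$ for which the max-product system with matrix $A$ and second member $c$ is consistent. Then $$\Delta=\max_{1\le i\le n}\delta_i,$$ where for $i=1,2,\dots,n$: $$\delta_i=\min_{1\le j\le m}\ \max_{1\le k\le n}\ \sigma_{GG}(a_{ij},b_i,a_{kj},b_k).$$
   Context: $n,m\ge 1$ are integers; $[0,1]^{n\times m}$ is the set of $n\times m$ matrices with entries in $[0,1]$. The max-product system with matrix $A$ and second member $c=[c_i]\in[0,1]^{n\times 1}$ is: find $x=[x_j]\in[0,1]^{m\times 1}$ with $\max_{1\le j\le m}a_{ij}\cdot x_j=c_i$ for all $i\in\{1,\dots,n\}$; it is consistent if such an $x$ exists. $\Vert b-c\Vert=\max_{1\le i\le n}|b_i-c_i|$. For real $t$, $t^+=\max(t,0)$. For $u,x,y,z\in[0,1]$, $$\sigma_{GG}(u,x,y,z)=\max\big[(x-u)^+,\ \min(\varphi(u,x,y,z),(y-z)^+)\big],$$ where $\varphi(u,x,y,z)=\dfrac{(x\cdot y-u\cdot z)^+}{u+y}$ if $u>0$ and $\varphi(u,x,y,z)=x$ if $u=0$. *)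

(* Defs.v *)
From HB Require Import structures.
From mathcomp Require Import all_boot all_order all_algebra.
From mathcomp Require Import classical_sets reals topology normedtype.

Set Implicit Arguments.
Unset Strict Implicit.
Unset Printing Implicit Defensive.

Import Order.TTheory GRing.Theory Num.Theory.
Import numFieldNormedType.Exports.

Local Open Scope classical_set_scope.
Local Open Scope ring_scope.

(* Dimensions are written n.+1 and m.+1, so that the index sets are nonempty.
   Seeding the fold with F ord0, itself one of the terms, makes these the exact
   maximum and minimum of F, with no artificial neutral element. *)
Definition max_ord (R : realType) (n : nat) (F : 'I_n.+1 -> R) : R :=
  \big[Num.max/F ord0]_(i < n.+1) F i.

Definition min_ord (R : realType) (n : nat) (F : 'I_n.+1 -> R) : R :=
  \big[Num.min/F ord0]_(i < n.+1) F i.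

Definition unit_entries (R : realType) (n m : nat) (A : 'M[R]_(n, m)) : Prop :=
  forall i j, 0 <= A i j <= 1.

Definition maxprod (R : realType) (n m : nat)
    (A : 'M[R]_(n.+1, m.+1)) (x : 'cV[R]_m.+1) : 'cV[R]_n.+1 :=
  \col_i max_ord (fun j => A i j * x j 0).

Definition consistent (R : realType) (n m : nat)
    (A : 'M[R]_(n.+1, m.+1)) (c : 'cV[R]_n.+1) : Prop :=
  exists x : 'cV[R]_m.+1, unit_entries x /\ maxprod A x = c.

Definition consistent_set (R : realType) (n m : nat)
    (A : 'M[R]_(n.+1, m.+1)) : set 'cV[R]_n.+1 :=
  [set c | unit_entries c /\ consistent A c].

(* The library norm on matrices is the sup norm max_i |b_i - c_i|.
   The infimum is a genuine one: the set contains `|b| (take c = 0, x = 0) and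
   is bounded below by 0. *)
Definition chebyshev_distance (R : realType) (n m : nat)
    (A : 'M[R]_(n.+1, m.+1)) (b : 'cV[R]_n.+1) : R :=
  inf [set `|b - c| | c in consistent_set A].

Definition pos_part (R : realType) (t : R) : R := Num.max t 0.

(* For the intended u in [0,1], the second branch is the case u = 0. *)
Definition phi (R : realType) (u x y z : R) : R :=
  if 0 < u then pos_part (x * y - u * z) / (u + y) else x.

Definition sigmaGG (R : realType) (u x y z : R) : R :=
  Num.max (pos_part (x - u)) (Num.min (phi u x y z) (pos_part (y - z))).

Definition delta (R : realType) (n m : nat)
    (A : 'M[R]_(n.+1, m.+1)) (b : 'cV[R]_n.+1) (i : 'I_n.+1) : R :=
  min_ord (fun j => max_ord (fun k => sigmaGG (A i j) (b i 0) (A k j) (b k 0))).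

(* Main.v *)
Require Import Defs.
From mathcomp Require Import all_boot all_order all_algebra.
From mathcomp Require Import classical_sets reals topology normedtype.
From mathcomp Require Import boolp lra.

(** A vector [x] satisfies [`|b - maxprod A x| <= d] iff every row [i] has a
    column [j] with [b i - d <= A i j * x j], while [A k j * x j <= b k + d] for
    all [k] and [j].  Taking [x] maximal for the upper constraints eliminates it:
    there remains that each [i] has a [j] such that, for all [k],
    [b i - d <= A i j] and [A k j * (b i - d) <= A i j * (b k + d)].  The function
    [sigmaGG] is the least [d >= 0] for which these two inequalities hold. *)

Set Implicit Arguments.
Unset Strict Implicit.
Unset Printing Implicit Defensive.

Import Order.TTheory GRing.Theory Num.Theory.
Import numFieldNormedType.Exports.

Local Open Scope classical_set_scope.
Local Open Scope ring_scope.

Lemma max_ord_leP (R : realType) n (F : 'I_n.+1 -> R) d :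
  reflect (forall i, F i <= d) (max_ord F <= d).
Proof.
apply: (iffP (bigmax_leP _ _ _ _)) => [[_ h] i|h]; first exact: h.
by split=> [|i _]; exact: h.
Qed.

Lemma max_ord_geP (R : realType) n (F : 'I_n.+1 -> R) d :
  reflect (exists i, d <= F i) (d <= max_ord F).
Proof.
apply: (iffP (bigmax_geP _ _ _ _)) => [[h|[i _ h]]|[i h]].
(* The seed of the fold is the term at [ord0], so it too has an index as witness. *)
- by exists ord0.
- by exists i.
- by right; exists i.
Qed.

Lemma min_ord_leP (R : realType) n (F : 'I_n.+1 -> R) d :
  reflect (exists i, F i <= d) (min_ord F <= d).
Proof.
apply: (iffP (bigmin_leP _ _ _ _)) => [[h|[i _ h]]|[i h]].
- by exists ord0.
- by exists i.
- by right; exists i.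
Qed.

(** The norm is a maximum seeded with 0, whence the condition [0 <= d]. *)
Lemma cV_norm_leP (R : realType) n (v : 'cV[R]_n) d : 0 <= d ->
  reflect (forall i, `|v i 0| <= d) (`|v| <= d).
Proof.
move=> d0; rewrite [`|v|]mx_normrE.
apply: (iffP (bigmax_leP _ _ _ _)) => [[_ h] i|h]; first exact: (h (i, 0)).
by split=> // -[i j] _ /=; rewrite ord1.
Qed.

Lemma sigmaGG_ge0 (R : realType) (u x y z : R) : 0 <= sigmaGG u x y z.
Proof. by rewrite /sigmaGG /pos_part !le_max lexx orbT. Qed.

(** For [u > 0], clearing the denominator [u + y] turns [phi u x y z <= d] into the product
    inequality. For [u = 0], the first inequality gives [x <= d] and both sides hold. *)
Lemma sigmaGG_le (R : realType) (u x y z d : R) :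
    0 <= u -> 0 <= y -> 0 <= z -> 0 <= d ->
  (sigmaGG u x y z <= d) = (x - d <= u) && (y * (x - d) <= u * (z + d)).
Proof.
move=> u0 y0 z0 d0.
rewrite /sigmaGG /phi /pos_part ge_max ge_min !ge_max d0 !andbT.
have -> : (x - u <= d) = (x - d <= u) by lra.
case: (leP (x - d) u) => //= xdu.
case: (ltP 0 u) => [upos|un0]; last first.
  have u_eq0 : u = 0 by lra.
  rewrite u_eq0 mul0r in xdu *.
  rewrite mulr_ge0_le0 // -[x <= d]subr_le0 xdu //.
rewrite ler_pdivrMr; last by lra.
rewrite ge_max mulr_ge0 ?addr_ge0 // andbT.
have -> : (x * y - u * z <= d * (u + y)) = (y * (x - d) <= u * (z + d)).
  by apply/idP/idP => h; nra.
(* The other branch of the minimum adds nothing: [y <= z + d] and [x - d <= u] already imply the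
   product inequality. *)
case: leP => //= h; apply/negbTE; rewrite -ltNge ltrBrDr.
rewrite ltNge; apply/negP => yzd.
have [xd|xd] := leP 0 (x - d); first by nra.
by have := mulr_ge0 u0 (addr_ge0 z0 d0); nra.
Qed.

Section Approximation.
Variables (R : realType) (n m : nat).
Variables (A : 'M[R]_(n.+1, m.+1)) (b : 'cV[R]_n.+1).
Hypotheses (hA : unit_entries A) (hb : unit_entries b).

Lemma max_delta_leP d : 0 <= d ->
  reflect (forall i, exists j, forall k, b i 0 - d <= A i j /\
             A k j * (b i 0 - d) <= A i j * (b k 0 + d))
          (max_ord (delta A b) <= d).
Proof.
move=> d0.
have sE i j k : sigmaGG (A i j) (b i 0) (A k j) (b k 0) <= d <->
    b i 0 - d <= A i j /\ A k j * (b i 0 - d) <= A i j * (b k 0 + d).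
  have [[/andP[? _] /andP[? _]] /andP[? _]] := (hA i j, hA k j, hb k 0).
  by rewrite sigmaGG_le //; split=> /andP.
apply: (iffP (max_ord_leP _ _)) => h i.
  have /min_ord_leP[j /max_ord_leP hj] := h i.
  by exists j => k; apply/sE.
have [j hj] := h i.
by apply/min_ord_leP; exists j; apply/max_ord_leP => k; apply/sE.
Qed.

Lemma max_delta_ge0 : 0 <= max_ord (delta A b).
Proof.
apply/max_ord_geP; exists ord0; rewrite /delta.
apply/bigmin_geP; split=> [|j _]; apply/max_ord_geP; exists ord0;
  exact: sigmaGG_ge0.
Qed.

Lemma unit_entries_maxprod (x : 'cV[R]_m.+1) :
  unit_entries x -> unit_entries (maxprod A x).
Proof.
move=> hx i j; rewrite mxE; apply/andP; split.
  apply/max_ord_geP; exists ord0.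
  by apply: mulr_ge0; [have /andP[] := hA i ord0 | have /andP[] := hx ord0 0].
apply/max_ord_leP => k.
have [/andP[? ?] /andP[? ?]] := (hA i k, hx k 0).
exact: mulr_ile1.
Qed.

(** For row [i], pick a column [j] with [b i - d <= A i j * x j]. Then [x j <= 1] gives the first
    inequality of the criterion; multiplying by [A k j] and using [A k j * x j <= b k + d] gives the
    second. *)
Lemma max_delta_le_norm (x : 'cV[R]_m.+1) : unit_entries x ->
  max_ord (delta A b) <= `|b - maxprod A x|.
Proof.
move=> hx; set d := `|_|.
have d0 : 0 <= d by exact: normr_ge0.
have /(cV_norm_leP _ d0) hd : d <= d by [].
have {}hd i : b i 0 - d <= maxprod A x i 0 <= b i 0 + d.
  by have := hd i; rewrite !mxE ler_norml; lra.
apply/(max_delta_leP d0) => i.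
have /andP[] := hd i; rewrite mxE => /max_ord_geP[j hj] _.
have /andP[xj0 xj1] := hx j 0; have /andP[Aij0 _] := hA i j.
exists j => k; have /andP[Akj0 _] := hA k j.
have /andP[_] := hd k; rewrite mxE => /max_ord_leP /(_ j) hk.
by split; nra.
Qed.

(** The residual of [b + d] for the product (Goguen) implication. The seed 1 enforces [x j <= 1];
    rows with [A k j = 0] do not constrain [x j]. *)
Definition greatest_subsolution (d : R) : 'cV[R]_m.+1 :=
  \col_j \big[Num.min/1]_(k < n.+1 | 0 < A k j) ((b k 0 + d) / A k j).

Lemma greatest_subsolution_unit d : 0 <= d ->
  unit_entries (greatest_subsolution d).
Proof.
move=> d0 j l; rewrite mxE; apply/andP; split; last exact: bigmin_le_id.
apply/bigmin_geP; split=> [|k Akj]; first exact: ler01.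
by rewrite divr_ge0 ?(ltW Akj) // addr_ge0 //; have /andP[] := hb k 0.
Qed.

Lemma greatest_subsolution_approx d : 0 <= d -> max_ord (delta A b) <= d ->
  `|b - maxprod A (greatest_subsolution d)| <= d.
Proof.
move=> d0 /(max_delta_leP d0) h; apply/(cV_norm_leP _ d0) => i.
have hx := greatest_subsolution_unit d0.
rewrite mxE [X in _ + X]mxE ler_distlC [maxprod _ _ _ _]mxE; apply/andP; split.
  have [j hj] := h i; apply/max_ord_geP; exists j.
  have /andP[Aij0 Aij1] := hA i j.
  (* Once [b i - d > 0], the criterion forces [A i j > 0]. Dividing by it, its two inequalities
     bound [(b i - d) / A i j] by the seed 1 and by each quotient in the minimum. *)
  have [bid|bid] := leP (b i 0 - d) 0.
    by apply: (le_trans bid); rewrite mulr_ge0 //; have /andP[] := hx j 0.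
  have Aij : 0 < A i j by apply: lt_le_trans (hj i).1.
  rewrite mulrC -ler_pdivrMr // mxE.
  apply/bigmin_geP; split=> [|k Akj].
    by rewrite ler_pdivrMr // mul1r; exact: (hj i).1.
  rewrite ler_pdivrMr // mulrAC ler_pdivlMr //.
  by rewrite [leLHS]mulrC [leRHS]mulrC; exact: (hj k).2.
(* The upper bound holds by construction of the residual, or trivially where [A i j = 0]. *)
apply/max_ord_leP => j.
have /andP[Aij0 Aij1] := hA i j; have /andP[bi0 _] := hb i 0.
have [Aij|Aij] := ltP 0 (A i j); last first.
  by rewrite (le_anti (introT andP (conj Aij Aij0))) mul0r addr_ge0.
by rewrite mulrC -ler_pdivlMr // mxE; exact: bigmin_le_cond.
Qed.

End Approximation.

Theorem theorem4 (R : realType) (n m : nat)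
    (A : 'M[R]_(n.+1, m.+1)) (b : 'cV[R]_n.+1)
    (hA : unit_entries A) (hb : unit_entries b) :
  chebyshev_distance A b = max_ord (fun i : 'I_n.+1 => delta A b i).
Proof.
have D0 := max_delta_ge0 A b; set D := max_ord _.
(* With [d = D], this [x] yields a consistent second member within [D] of [b], so the infimum is
   attained. *)
set x := greatest_subsolution A b D.
have hx : unit_entries x by exact: greatest_subsolution_unit.
have Cx : consistent_set A (maxprod A x).
  by split; [exact: unit_entries_maxprod | exists x].
have lbD : lbound [set `|b - c| | c in consistent_set A] D.
  by move=> _ [_ [_ [y [hy <-]]] <-]; exact: max_delta_le_norm.
apply/eqP; rewrite eq_le; apply/andP; split.
  apply: (@le_trans _ _ `|b - maxprod A x|).
    by apply: ge_inf; [exists D | exists (maxprod A x)].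
  exact: greatest_subsolution_approx.
by apply: lb_le_inf => //; exists `|b - maxprod A x|; exists (maxprod A x).
Qed.
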